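(* Let $\mathbf X\sim\mathcal N(\mathbf 0,\boldsymbol\Sigma)$ in $\mathbb R^d$ with $\boldsymbol\Sigma$ positive definite, eigenvalues $\lambda_1\ge\cdots\ge\lambda_d>0$ and orthonormal eigenvectors $v_1,\dots,v_d$; let $\mathbf V=(v_1,\dots,v_d)$ and $\mathbf Y=\mathbf V'\mathbf X$. For $\alpha\in(0,1)$ and $i\in\{1,\dots,d\}$ let $\boldsymbol\Lambda_{i,\alpha}:=\mathrm{Cov}(\mathbf Y\mid Y_i\in\mathsf T^\alpha_{Y_i})$. Then $\mathrm{Tr}(\boldsymbol\Lambda_{1,\alpha})\le\mathrm{Tr}(\boldsymbol\Lambda_{i,\alpha})\le\mathrm{Tr}(\boldsymbol\Lambda_{d,\alpha})$ for all $i$; i.e. the preserved total variance is maximized by peeling $Y_d$ and minimized by peeling $Y_1$.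
   Context: For a real random variable $W$, $Q_W(p)=\inf\{x:\mathbb P(W\le x)\ge p\}$ is its $p$-quantile and $\mathsf T^\alpha_W:=[Q_W(\alpha/2),Q_W(1-\alpha/2)]$. *)

(* Defs.v *)
From HB Require Import structures.
From mathcomp Require Import all_boot all_order all_algebra.
From mathcomp Require Import all_classical all_reals all_analysis.
Set Implicit Arguments. Unset Strict Implicit. Unset Printing Implicit Defensive.
Import Order.TTheory GRing.Theory Num.Theory.
Import numFieldNormedType.Exports.
Local Open Scope classical_set_scope.
Local Open Scope ring_scope.

Section Defs.
Context {dT : measure_display} {T : measurableType dT} {R : realType}.
Variable P : probability T R.

Definition has_law (W : T -> R) (mu : set R -> \bar R) : Prop :=
  measurable_fun setT W /\
  forall B : set R, measurable B -> P (W @^-1` B) = mu B.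

(* X = (X_0,...,X_{n-1}) is a centred Gaussian vector with covariance Sigma:
   every linear combination a'X is N(0, a' Sigma a) (Cramer-Wold),
   with the degenerate case a' Sigma a = 0 meaning the Dirac mass at 0. *)
Definition gaussian_vector (n : nat) (X : 'I_n -> T -> R) (Sigma : 'M[R]_n) :=
  forall a : 'I_n -> R,
    let v := \sum_(j < n) \sum_(k < n) a j * Sigma j k * a k in
    has_law (fun w => \sum_(j < n) a j * X j w)
      (if 0 < v then normal_prob 0 (Num.sqrt v) else \d_(0:R)).

Definition quantile (W : T -> R) (p : R) : R :=
  inf [set x : R | (p%:E <= P [set w | (W w <= x)%R])%E].

Definition trim_event (W : T -> R) (alpha : R) : set T :=
  [set w | quantile W (alpha / 2) <= W w <= quantile W (1 - alpha / 2)].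

(* conditional expectation given an event A (with P A > 0) *)
Definition condE (A : set T) (W : T -> R) : R :=
  (\int[P]_(w in A) W w) / fine (P A).

Definition condCov (n : nat) (Y : 'I_n -> T -> R) (A : set T) : 'M[R]_n :=
  \matrix_(j, k) (condE A (fun w => Y j w * Y k w)
                  - condE A (Y j) * condE A (Y k)).

End Defs.

(* Main.v *)
Require Import Defs.
From HB Require Import structures.
From mathcomp Require Import all_boot all_order all_algebra.
From mathcomp Require Import all_classical all_reals all_analysis.
From mathcomp Require Import measurable_realfun ring lra.
Import Order.TTheory GRing.Theory Num.Theory.
Import numFieldNormedType.Exports.
Local Open Scope classical_set_scope.
Local Open Scope ring_scope.

(* Put U_i = Y_i / sqrt(lambda_i) and let [a, b] be the trimming interval of the
   standard normal law. Cramer-Wold only gives the laws of linear combinations,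
   and independence of U_i and U_j is never established. Instead, let f be the
   C^1 function with f' = clip a b, so that f'' is the indicator of [a, b] off
   {a, b}. By dominated convergence, E[U_j^2; U_i in [a, b]] is the limit of
     E[f(U_i + e U_j) + f(U_i - e U_j) - 2 f(U_i)] / e^2   as e -> 0,
   and this only involves the laws N(0, 1 + e^2) and N(0, 1): the limit K is the
   same for all i != j. A first difference of f' likewise gives
   E[U_j; U_i in [a, b]] = 0. Hence, with p and v the probability of [a, b] and the
   variance of the standard normal law conditioned on [a, b],
     Tr Lambda_i = (sum_j lambda_j) K / p - lambda_i (K / p - v),
   and it remains to see that v <= K / p. This follows from convexity,
   f(t x) - f(x) >= (t - 1) x f'(x) with t = sqrt(1 + e^2), because a <= 0 <= b. *)

(** * Projection onto an interval and its convex primitive *)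

Section clip.
Context {R : realType}.
Implicit Types a b c h m t x y : R.

Definition clip a b x : R := Num.max a (Num.min x b).

(** The function f of the proof idea in closed form: with c the projection of x onto [a, b], it
    equals (x^2 - (x - c)^2) / 2, which is quadratic on [a, b] and affine on either side. *)
Definition huber a b x : R := x * clip a b x - clip a b x ^+ 2 / 2.

Lemma clip_itv a b x : a <= b -> a <= clip a b x <= b.
Proof. by rewrite /clip => ab; case: (leP x b) => ?; [case: (leP a x)|case: (leP a b)] => ?; apply/andP; split; lra. Qed.

(** Variational inequality of the projection onto a convex set; the convexity and smoothness bounds
    below both reduce to it. *)
Lemma clip_proj a b x c : a <= c <= b -> 0 <= (clip a b x - c) * (x - clip a b x).
Proof.
rewrite /clip => /andP[ac cb].
by case: (leP x b) => ?; [case: (leP a x)|case: (leP a b)] => ?; nra.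
Qed.

Lemma clip_id a b x : a <= x <= b -> clip a b x = x.
Proof. by rewrite /clip => /andP[? ?]; case: (leP x b) => ?; [case: (leP a x)|case: (leP a b)] => ?; lra. Qed.

Lemma clip_lt a b x : a <= b -> x < a -> clip a b x = a.
Proof. by rewrite /clip => ? ?; case: (leP x b) => ?; [case: (leP a x)|case: (leP a b)] => ?; lra. Qed.

Lemma clip_gt a b x : a <= b -> b < x -> clip a b x = b.
Proof. by rewrite /clip => ? ?; case: (leP x b) => ?; [case: (leP a x)|case: (leP a b)] => ?; lra. Qed.

Lemma clip_lipschitz a b x y : `|clip a b x - clip a b y| <= `|x - y|.
Proof.
rewrite ler_norml /clip; case: (leP x b) => ?; case: (leP y b) => ?;
  case: (leP a x) => ?; case: (leP a y) => ?; case: (leP a b) => ?;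
  case: (ger0P (x - y)) => ?; apply/andP; split; lra.
Qed.

(** With c, e the projections of x, y, the gap is exactly (e - c) (y - e) + (e - c)^2 / 2. *)
Lemma huber_convex a b x y : a <= b ->
  huber a b x + (y - x) * clip a b x <= huber a b y.
Proof.
move=> ab; have := clip_proj a b y _ (clip_itv a b x ab).
rewrite /huber; set c := clip a b x; set e := clip a b y => H.
have := sqr_ge0 (c - e); nra.
Qed.

(** Here the gap is (c - e) (x - c) + (y - x - (e - c))^2 / 2, with c, e the projections of x, y. *)
Lemma huber_smooth a b x y : a <= b ->
  huber a b y <= huber a b x + (y - x) * clip a b x + (y - x) ^+ 2 / 2.
Proof.
move=> ab; have := clip_proj a b x _ (clip_itv a b y ab).
rewrite /huber; set c := clip a b x; set e := clip a b y => H.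
have := sqr_ge0 (y - x - (e - c)); nra.
Qed.

(** The first-order terms at x + h and x - h cancel. The upper bound later provides the dominating
    function W^2. *)
Lemma huber_second_difference a b x h : a <= b ->
  0 <= huber a b (x + h) + huber a b (x - h) - 2 * huber a b x <= h ^+ 2.
Proof.
move=> ab; have := huber_convex a b x (x + h) ab; have := huber_convex a b x (x - h) ab.
have := huber_smooth a b x (x + h) ab; have := huber_smooth a b x (x - h) ab.
by move=> *; apply/andP; split; nra.
Qed.

Lemma huber_bound a b x : a <= b -> `|huber a b x| <= (a ^+ 2 + b ^+ 2) + x ^+ 2.
Proof.
move=> ab; rewrite /huber; have := clip_itv a b x ab; set c := clip a b x => /andP[? ?].
have c2 : c ^+ 2 <= a ^+ 2 + b ^+ 2.
  by have := sqr_ge0 a; have := sqr_ge0 b; case: (leP 0 c) => ?; nra.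
have := sqr_ge0 (x - c); have := sqr_ge0 (x + c).
by move=> ? ?; rewrite ler_norml; apply/andP; split; nra.
Qed.

Lemma trim_side a b x : a <= b -> x != a -> x != b ->
  [\/ x < a, b < x | a < x < b].
Proof.
move=> ab xa xb; case: (ltgtP x a) => [?|?|xaE]; first by constructor 1.
- case: (ltgtP x b) => [?|?|xbE]; [by constructor 3; apply/andP|by constructor 2|].
  by rewrite xbE eqxx in xb.
- by rewrite xaE eqxx in xa.
Qed.

(** Away from the two kinks of [clip], f is a single quadratic or affine piece near x, so for small
    h the differences are exact and the difference quotients are eventually constant. *)
Lemma huber_second_difference_local a b x : a <= b -> x != a -> x != b ->
  exists2 e, 0 < e & forall h, `|h| < e ->
    huber a b (x + h) + huber a b (x - h) - 2 * huber a b x =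
    (if a <= x <= b then h ^+ 2 else 0) /\
    clip a b (x + h) - clip a b (x - h) = (if a <= x <= b then 2 * h else 0).
Proof.
move=> ab xa xb; case: (trim_side a b x ab xa xb) => [ltxa|ltbx|/andP[ltax ltxb]].
- exists (a - x); first by rewrite subr_gt0.
  move=> h; rewrite ltr_norml => /andP[? ?]; rewrite leNgt ltxa /= /huber.
  by rewrite !clip_lt//; first (split; lra); lra.
- exists (x - b); first by rewrite subr_gt0.
  move=> h; rewrite ltr_norml => /andP[? ?]; rewrite (leNgt x) ltbx andbF /= /huber.
  by rewrite !clip_gt//; first (split; lra); lra.
- exists (Num.min (x - a) (b - x)); first by rewrite lt_min !subr_gt0 ltax.
  move=> h; rewrite lt_min !ltr_norml => /andP[/andP[? ?] /andP[? ?]].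
  rewrite (ltW ltax) (ltW ltxb) /= /huber.
  by rewrite !clip_id//; first (split; lra); apply/andP; split; lra.
Qed.

(* Outside the interval [clip a b x - m] has the sign of [x], since 0 lies in the interval. *)
Lemma huber_dilation a b m t x : a <= 0 <= b -> a <= m <= b -> 1 <= t ->
  (t - 1) * (if a <= x <= b then x ^+ 2 - m * x else 0) <=
  huber a b (t * x) - huber a b x - (t - 1) * m * x.
Proof.
move=> /andP[a0 b0] /andP[am mb] t1.
have ab : a <= b by lra.
have := huber_convex a b x (t * x) ab.
suff : (if a <= x <= b then x ^+ 2 - m * x else 0) <= x * clip a b x - m * x by nra.
case: ifPn => [/clip_id ->|]; first lra.
rewrite negb_and -!ltNge => /orP[?|?]; [rewrite clip_lt//|rewrite clip_gt//]; nra.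
Qed.

End clip.

(** * Integration against a law, and the second moment of the standard normal law *)

Section law.
Context {dT : measure_display} {T : measurableType dT} {R : realType}.
Variable P : probability T R.
Implicit Types (U W : T -> R) (mu : {measure set (measurableTypeR R) -> \bar R}).

(** Change of variables, applied to the positive and negative parts of f separately. *)
Lemma has_law_integral W mu (f : R -> R) : has_law P W mu ->
  measurable_fun [set: R] f -> \int[P]_w f (W w) = \int[mu]_x f x.
Proof.
move=> [mW lW] mf; congr fine; rewrite integralE [RHS]integralE.
have mF : measurable_fun [set: R] (fun x => (f x)%:E) by exact/measurable_EFinP.
have eq_ge0 (g : R -> \bar R) : measurable_fun [set: R] g -> (forall x, 0 <= g x)%E ->
    (\int[P]_w g (W w) = \int[mu]_x g x)%E.
  move=> mg g0; rewrite -(@ge0_integral_pushforward _ _ T (measurableTypeR R) R W mW P setT g)//.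
  by apply: eq_measure_integral => A mA _; rewrite -lW.
congr (_ - _)%E; rewrite -eq_ge0//.
- by rewrite -[X in _ = X]/(\int[P]_w ((EFin \o f)^\+ \o W) w)%E -funepos_comp.
- exact: measurable_funepos.
- by rewrite -[X in _ = X]/(\int[P]_w ((EFin \o f)^\- \o W) w)%E -funeneg_comp.
- exact: measurable_funeneg.
Qed.

Lemma measurable_square_gt (r : R) : measurable [set x : R | r < x ^+ 2].
Proof.
rewrite (_ : [set _ | _] = (fun x : R => x ^+ 2) @^-1` `]r, +oo[); last first.
  by apply/seteqP; split => x /=; rewrite in_itv /= andbT.
by rewrite -[X in measurable X]setTI; exact: exprn_measurable.
Qed.

(** On r < x^2 one factor exp(-x^2/4) of the density is at most exp(-r/4); the other is, up to the
    factor sqrt 2, the density of N(0, 2), whose total mass is 1. *)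
Lemma normal_tail (r : R) : 
  (normal_prob 0 1 [set x : R | (r < x ^+ 2)%R] <=
   (Num.sqrt 2 * expR (- (r / 4)))%:E)%E.
Proof.
have m := measurable_square_gt r.
have s2 : Num.sqrt 2 != 0 :> R by rewrite sqrtr_eq0 -ltNge.
rewrite /normal_prob (@le_trans _ _ (\int[lebesgue_measure]_(x in [set x : R | (r < x ^+ 2)%R])
   ((Num.sqrt 2 * expR (- (r / 4)))%:E * (normal_pdf 0 (Num.sqrt 2) x)%:E))%E)//.
  apply: ge0_le_integral => //=.
  - by move=> x _; rewrite lee_fin normal_pdf_ge0.
  - by apply/measurable_EFinP/measurable_funTS; exact: measurable_normal_pdf.
  - apply/measurable_EFinP/measurable_funM => //.
    by apply: measurable_funTS; exact: measurable_normal_pdf.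
  - move=> x rx; rewrite lee_fin !normal_pdfE ?oner_eq0// /normal_peak /normal_fun.
    rewrite sqr_sqrtr// !subr0 expr1n mul1r.
    have -> : 2 * pi *+ 2 = 2 * (pi *+ 2) :> R by ring.
    rewrite [in leRHS]sqrtrM// invfM.
    have -> : - x ^+ 2 / (1 *+ 2) = - (x ^+ 2 / 4) + - x ^+ 2 / (2 *+ 2) :> R by field.
    rewrite expRD.
    set p := (_ (_ *+ 2))^-1; set q := Num.sqrt 2 in s2 *; set E := expR (_ / _).
    have -> : q * expR (- (r / 4)) * (q^-1 * p * E) = p * (expR (- (r / 4)) * E) by field.
    apply: ler_wpM2l; first by rewrite invr_ge0.
    apply: ler_wpM2r; first exact: expR_ge0.
    rewrite ler_expR; lra.
rewrite integralZl//=; last first.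
  by apply: (integrableS measurableT) => //; exact: integrable_normal_pdf.
rewrite -[leRHS]mule1 lee_wpmul2l// ?lee_fin ?mulr_ge0 ?expR_ge0//.
rewrite -[leRHS](@integral_normal_pdf R 0 (Num.sqrt 2)); apply: ge0_subset_integral => //=.
- by apply/measurable_EFinP; exact: measurable_normal_pdf.
- by move=> x _; rewrite lee_fin normal_pdf_ge0.
Qed.

(** Layer-cake formula: E[W^2] is the integral of P(W^2 > r) over r >= 0, and [normal_tail] bounds
    the integrand by a multiple of the exponential density of rate 1/4. The factor 4 in that
    multiple cancels the rate in the density. *)
Lemma normal_square_integrable W : has_law P W (normal_prob 0 1) ->
  P.-integrable setT (EFin \o (fun w => W w ^+ 2)).
Proof.
move=> [mW lW].
have mW2 : measurable_fun setT (fun w => W w ^+ 2) by exact: measurable_funX.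
pose mix := isMeasurableFun.Build _ _ _ _ _ mW2.
pose X : {RV P >-> R} := HB.pack (fun w => W w ^+ 2) mix.
have exp_lty : (\int[lebesgue_measure]_(r in `[0%R, +oo[)
    (exponential_pdf (4^-1 : R) r)%:E < +oo)%E.
  rewrite (@le_lt_trans _ _ 1%E)// ?ltry//.
  rewrite -(@integral_exponential_pdf R 4^-1)//; apply: ge0_subset_integral => //=.
  - by apply/measurable_EFinP; exact: measurable_exponential_pdf.
  - by move=> x _; rewrite lee_fin exponential_pdf_ge0.
apply/integrableP; split; first exact/measurable_EFinP.
under eq_integral do rewrite /= ger0_norm ?sqr_ge0//.
have -> : (\int[P]_w (W w ^+ 2)%:E = 'E_P[X])%E by rewrite expectation_def.
rewrite ge0_expectation_ccdf; last by move=> x; exact: sqr_ge0.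
rewrite (@le_lt_trans _ _ (\int[lebesgue_measure]_(r in `[0%R, +oo[)
   ((Num.sqrt 2 * 4)%:E * (exponential_pdf (4^-1) r)%:E))%E)//.
  apply: ge0_le_integral => //=.
  - by apply: measurable_funTS; exact: ccdf_measurable.
  - by apply/measurable_EFinP/measurable_funM => //;
      apply: measurable_funTS; exact: measurable_exponential_pdf.
  - move=> r; rewrite in_itv/= andbT => r0.
    rewrite exponential_pdfE//.
    have -> : ccdf X r = normal_prob 0 1 [set x : R | (r < x ^+ 2)%R].
      rewrite -lW; last exact: measurable_square_gt.
      rewrite /ccdf /distribution /pushforward; congr (P _).
      by apply/seteqP; split => x /=; rewrite in_itv /= andbT.
    rewrite (le_trans (normal_tail r))// -EFinM lee_fin.
    by rewrite mulrA mulfK// mulNr [_ * r]mulrC.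
rewrite integralZl//=; last first.
  apply/integrableP; split.
    by apply/measurable_EFinP/measurable_funTS; exact: measurable_exponential_pdf.
  by under eq_integral do rewrite /= ger0_norm ?exponential_pdf_ge0//.
by rewrite lte_mul_pinfty.
Qed.

End law.

(** * Dominated convergence for real-valued integrals *)

Lemma dominated_convergence_Rintegral {d : measure_display} {T : measurableType d}
    {R : realType} (mu : {measure set T -> \bar R}) (f_ : nat -> T -> R) (f g : T -> R) :
  (forall n, measurable_fun setT (f_ n)) -> measurable_fun setT f ->
  {ae mu, forall x, f_ n x @[n --> \oo] --> f x} ->
  mu.-integrable setT (EFin \o g) -> (forall n x, `|f_ n x| <= g x) ->
  \int[mu]_x f_ n x @[n --> \oo] --> \int[mu]_x f x.
Proof.
move=> mf_ mf cvf ig fg.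
have [|||||intf _ cv] := @dominated_convergence _ _ _ mu setT measurableT
  (fun n x => (f_ n x)%:E) (EFin \o f) (EFin \o g).
- by move=> n; exact/measurable_EFinP.
- exact/measurable_EFinP.
- by apply: filterS cvf => x fx _; apply: cvg_EFin => //; exact: nearW.
- by [].
- by apply: aeW => x n _; rewrite lee_fin.
apply: fine_cvg; rewrite fineK//; exact: integrable_fin_num.
Qed.

(** * Standard Gaussian pairs, described by the laws of their linear combinations *)

Section std_gaussian_pair.
Context {dT : measure_display} {T : measurableType dT} {R : realType}.
Variable P : probability T R.
Implicit Types (U W : T -> R) (a b m : R).

(** The standard bivariate normal law in Cramer-Wold form; the positivity condition leaves out x = y
    = 0, where the combination is degenerate. *)
Definition std_gaussian_pair U W := forall x y : R, 0 < x ^+ 2 + y ^+ 2 ->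
  has_law P (fun w => x * U w + y * W w)
            (normal_prob 0 (Num.sqrt (x ^+ 2 + y ^+ 2))).

Definition trim U a b := [set w | a <= U w <= b].

Lemma measurable_trim U a b : measurable_fun setT U -> measurable (trim U a b).
Proof.
move=> mU; rewrite (_ : trim U a b = U @^-1` `[a, b]).
  by rewrite -[X in measurable X]setTI; exact: mU.
by apply/seteqP; split => w /=; rewrite in_itv.
Qed.

Lemma measurable_clip a b : measurable_fun [set: R] (clip a b).
Proof.
by apply: measurable_maxr => //; apply: measurable_minr.
Qed.

Lemma measurable_huber a b : measurable_fun [set: R] (huber a b).
Proof.
have mc := measurable_clip a b.
apply: measurable_funB; apply: measurable_funM => //; exact: measurable_funX.
Qed.

Lemma std_gaussian_pair_l U W : std_gaussian_pair U W ->
  has_law P U (normal_prob 0 1).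
Proof.
move=> /(_ 1 0); rewrite expr1n expr0n addr0 sqrtr1 => /(_ ltr01).
by under eq_fun do rewrite mul1r mul0r addr0.
Qed.

Lemma std_gaussian_pairC U W : std_gaussian_pair U W -> std_gaussian_pair W U.
Proof.
move=> h x y; rewrite addrC => /h.
by under eq_fun do rewrite addrC.
Qed.

Lemma std_normal_quadratic_integrable U W (g : T -> R) (c : R) :
  has_law P U (normal_prob 0 1) -> has_law P W (normal_prob 0 1) ->
  measurable_fun setT g -> 
  (forall w, `|g w| <= c * (1 + U w ^+ 2 + W w ^+ 2)) ->
  P.-integrable setT (EFin \o g).
Proof.
move=> hU hW mg gle.
apply: (@le_integrable _ _ _ P setT measurableT _
  (fun w => c%:E * (1%:E + (U w ^+ 2)%:E + (W w ^+ 2)%:E))%E) => //.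
- exact/measurable_EFinP.
- move=> w _; rewrite -!EFinD -EFinM /= lee_fin.
  exact: le_trans (gle w) (ler_norm _).
apply: integrableZl => //; apply: integrableD => //; last exact: normal_square_integrable.
apply: (@integrableD _ _ _ P setT measurableT (cst 1%E)) => //.
  exact: finite_measure_integrable_cst.
exact: normal_square_integrable.
Qed.

Lemma std_normal_ae_neq U q : has_law P U (normal_prob 0 1) -> {ae P, forall w, U w != q}.
Proof.
move=> [mU lU]; exists (U @^-1` [set q]); split.
- by rewrite -[X in measurable X]setTI; exact: mU.
- by rewrite lU//= /normal_prob integral_set1.
- by move=> w /= /negP; rewrite negbK => /eqP.
Qed.

Definition huber_mean a b (s : R) := \int[normal_prob 0 s]_x huber a b x.

(** U + h W and U - h W share the law N(0, 1 + h^2), whence the factor 2; the step h is 1/(n+1). No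
    random variable occurs, so the limit is common to all pairs. *)
Definition second_difference_mean a b (n : nat) :=
  2 * (huber_mean a b (Num.sqrt (1 + (harmonic n) ^+ 2)) - huber_mean a b 1) /
  (harmonic n) ^+ 2.

End std_gaussian_pair.

(** * Trimmed moments of the other variable as limits of difference quotients *)

Section difference_quotients.
Context {dT : measure_display} {T : measurableType dT} {R : realType}.
Variable P : probability T R.
Implicit Types (U W : T -> R) (a b m : R).

Lemma std_gaussian_pair_huber_integrable U W a b x y : a <= b ->
  std_gaussian_pair P U W ->
  P.-integrable setT (EFin \o (fun w => huber a b (x * U w + y * W w))).
Proof.
move=> ab hUW; have hU := std_gaussian_pair_l P _ _ hUW.
have hW := std_gaussian_pair_l P _ _ (std_gaussian_pairC P _ _ hUW).
(* The constant combines [huber_bound] with (x u + y v)^2 <= 2 x^2 u^2 + 2 y^2 v^2. *)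
apply: (std_normal_quadratic_integrable P U W _
  (a ^+ 2 + b ^+ 2 + 2 * x ^+ 2 + 2 * y ^+ 2)) => //.
  apply: (measurableT_comp (measurable_huber a b)).
  by apply: measurable_funD; apply: measurable_funM => //; [case: hU|case: hW].
move=> w; apply: (le_trans (huber_bound a b _ ab)).
set u := U w; set v := W w.
have := sqr_ge0 (x * u - y * v); have := sqr_ge0 u; have := sqr_ge0 v.
have := sqr_ge0 a; have := sqr_ge0 b; have := sqr_ge0 x; have := sqr_ge0 y.
have := sqr_ge0 (a * u); have := sqr_ge0 (b * u); have := sqr_ge0 (x * v); have := sqr_ge0 (y * u).
have := sqr_ge0 (a * v); have := sqr_ge0 (b * v).
move=> *; nra.
Qed.

Lemma std_gaussian_pair_huber_mean U W a b x y : std_gaussian_pair P U W ->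
  0 < x ^+ 2 + y ^+ 2 ->
  \int[P]_w huber a b (x * U w + y * W w) = huber_mean a b (Num.sqrt (x ^+ 2 + y ^+ 2)).
Proof.
move=> hUW xy; rewrite /huber_mean.
have := has_law_integral P _ (normal_prob 0 (Num.sqrt (x ^+ 2 + y ^+ 2)))
  (huber a b) (hUW x y xy).
by apply; exact: measurable_huber.
Qed.

Lemma near_harmonic_lt (c e : R) : 0 < e -> \forall n \near \oo, `|harmonic n * c| < e.
Proof.
move=> e0; have : harmonic n * c @[n --> \oo] --> (0 : R).
  by rewrite -[X in _ --> X](mul0r c); apply: cvgM; [exact: cvg_harmonic|exact: cvg_cst].
by move=> /cvgr0Pnorm_lt; exact.
Qed.

Lemma trim_if U a b (g : T -> R) w :
  (g \_ (trim U a b)) w = if a <= U w <= b then g w else 0.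
Proof. by rewrite patchE /trim mem_setE. Qed.

Lemma trim_ae_sides U a b : has_law P U (normal_prob 0 1) ->
  {ae P, forall w, U w != a /\ U w != b}.
Proof.
move=> hU; have := std_normal_ae_neq P U b hU; have := std_normal_ae_neq P U a hU.
by apply: filterS2 => w ? ?.
Qed.

(** The quotient [D n] has mean [second_difference_mean a b n], is dominated by W^2, and almost
    surely becomes equal to W^2 on the trimming event and to 0 off it. *)
Lemma cvg_second_difference_mean U W a b : a <= b -> std_gaussian_pair P U W ->
  second_difference_mean a b n @[n --> \oo] --> \int[P]_(w in trim U a b) W w ^+ 2.
Proof.
move=> ab hUW; have hU := std_gaussian_pair_l P _ _ hUW.
have hW := std_gaussian_pair_l P _ _ (std_gaussian_pairC P _ _ hUW).
have mU : measurable_fun setT U by case: hU.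
have mW : measurable_fun setT W by case: hW.
pose D n w : R := (huber a b (U w + harmonic n * W w) + huber a b (U w - harmonic n * W w)
   - 2 * huber a b (U w)) / harmonic n ^+ 2.
have h0 n : harmonic n != 0 :> R by rewrite gt_eqF// harmonic_gt0.
have DE n : second_difference_mean a b n = \int[P]_w D n w.
  have i1 := std_gaussian_pair_huber_integrable U W a b 1 (harmonic n) ab hUW.
  have i2 := std_gaussian_pair_huber_integrable U W a b 1 (- harmonic n) ab hUW.
  have i3 := std_gaussian_pair_huber_integrable U W a b 1 0 ab hUW.
  have e1 := std_gaussian_pair_huber_mean U W a b 1 (harmonic n) hUW.
  have e2 := std_gaussian_pair_huber_mean U W a b 1 (- harmonic n) hUW.
  have e3 := std_gaussian_pair_huber_mean U W a b 1 0 hUW.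
  rewrite /second_difference_mean.
  (* The coefficients 1, h, -h and 0 are made explicit so that the law of each combination can be
     read off. *)
  transitivity (\int[P]_w ((huber a b (1 * U w + harmonic n * W w) +
     huber a b (1 * U w + - harmonic n * W w)
     - 2 * huber a b (1 * U w + 0 * W w)) * (harmonic n ^+ 2)^-1)); last first.
    by apply: eq_Rintegral => w _; rewrite /D mul1r mul0r addr0 mulNr.
  have i12 : P.-integrable setT (EFin \o (fun w => huber a b (1 * U w + harmonic n * W w) +
     huber a b (1 * U w + - harmonic n * W w))) by exact: (integrableD measurableT i1 i2).
  have i23 : P.-integrable setT (EFin \o (fun w => 2 * huber a b (1 * U w + 0 * W w))).
    exact: (integrableZl measurableT 2 i3).
  rewrite RintegralZr//; last exact: (integrableB measurableT i12 i23).
  rewrite RintegralB// RintegralD// RintegralZl// e1 ?e2 ?e3.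
  - rewrite sqrrN !expr1n expr0n addr0 sqrtr1.
    move: (huber_mean _ _ _) (huber_mean _ _ 1) (_ ^-1) => x y z; ring.
  - by rewrite expr1n expr0n addr0.
  - by rewrite expr1n ltr_wpDr ?sqr_ge0.
  - by rewrite expr1n ltr_wpDr ?sqr_ge0.
under eq_fun do rewrite DE.
rewrite Rintegral_mkcond.
apply: (@dominated_convergence_Rintegral _ _ _ P D _ (fun w => W w ^+ 2)).
- move=> n; apply: measurable_funM => //; apply: measurable_funB.
    by apply: measurable_funD; apply: (measurableT_comp (measurable_huber a b));
      [apply: measurable_funD|apply: measurable_funB] => //; exact: measurable_funM.
  by apply: measurable_funM => //; exact: (measurableT_comp (measurable_huber a b)).
- apply/measurable_restrict => //; first exact: measurable_trim.
  by apply: measurable_funTS; exact: measurable_funX.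
- apply: filterS (trim_ae_sides U a b hU) => w [Ua Ub].
  have [e e0 he] := huber_second_difference_local a b _ ab Ua Ub.
  (* Once |h W| is below the distance from U to the kinks, the quotient no longer changes. *)
  apply: cvg_near_cst; near=> n.
  have [|De _] := he (harmonic n * W w); first by near: n; exact: near_harmonic_lt.
  rewrite trim_if /D De; case: ifP => _; last by rewrite mul0r.
  by rewrite exprMn mulrAC mulfV ?mul1r// expf_neq0.
- exact: normal_square_integrable.
- move=> n w; have /andP[D0 D1] := huber_second_difference a b (U w) (harmonic n * W w) ab.
  rewrite /D ger0_norm; last by rewrite divr_ge0 ?sqr_ge0.
  rewrite ler_pdivrMr ?exprn_even_gt0 ?h0//=.
  by rewrite [leRHS]mulrC -exprMn.
Unshelve. all: by end_near. Qed.

(** U + h W and U - h W have the same law, so every symmetric difference quotient of [clip] has mean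
    0. These quotients converge almost surely to W on the trimming event and to 0 off it, and are
    dominated by |W| since [clip] is 1-Lipschitz. *)
Lemma Rintegral_trim_other U W a b : a <= b -> std_gaussian_pair P U W ->
  \int[P]_(w in trim U a b) W w = 0.
Proof.
move=> ab hUW; have hU := std_gaussian_pair_l P _ _ hUW.
have hW := std_gaussian_pair_l P _ _ (std_gaussian_pairC P _ _ hUW).
have mU : measurable_fun setT U by case: hU.
have mW : measurable_fun setT W by case: hW.
pose D n w : R := (clip a b (U w + harmonic n * W w) - clip a b (U w - harmonic n * W w))
   / (2 * harmonic n).
have h0 n : 0 < harmonic n :> R by rewrite harmonic_gt0.
have bound w x : `|clip a b (1 * U w + x * W w)| <=
    (`|a| + `|b|) * (1 + U w ^+ 2 + W w ^+ 2).
  apply: (@le_trans _ _ (`|a| + `|b|)).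
    have /andP[? ?] := clip_itv a b (1 * U w + x * W w) ab.
    have := ler_norm a; have := ler_norm b; have := ler_norm (- a); have := ler_norm (- b).
    by rewrite !normrN => *; rewrite ler_norml; apply/andP; split; nra.
  rewrite ler_peMr ?addr_ge0//.
  by have := sqr_ge0 (U w); have := sqr_ge0 (W w); lra.
have mc x : measurable_fun setT (fun w => clip a b (1 * U w + x * W w)).
  by apply: (measurableT_comp (measurable_clip a b)); apply: measurable_funD;
    exact: measurable_funM.
have ic x := std_normal_quadratic_integrable P U W _ _ hU hW (mc x) (bound ^~ x).
have D0 n : \int[P]_w D n w = 0.
  transitivity (\int[P]_w ((clip a b (1 * U w + harmonic n * W w) -
     clip a b (1 * U w + - harmonic n * W w)) * (2 * harmonic n)^-1)).
    by apply: eq_Rintegral => w _; rewrite /D mul1r mulNr.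
  rewrite RintegralZr//; last exact: (integrableB measurableT (ic _) (ic _)).
  rewrite RintegralB//.
  rewrite (has_law_integral P _ (normal_prob 0 (Num.sqrt (1 ^+ 2 + harmonic n ^+ 2))) (clip a b) (hUW 1 (harmonic n) _))//; last 2 first.
  - by rewrite expr1n ltr_wpDr ?sqr_ge0.
  - exact: measurable_clip.
  rewrite (has_law_integral P _ (normal_prob 0 (Num.sqrt (1 ^+ 2 + (- harmonic n) ^+ 2))) (clip a b) (hUW 1 (- harmonic n) _))//; last 2 first.
  - by rewrite expr1n ltr_wpDr ?sqr_ge0.
  - exact: measurable_clip.
  by rewrite sqrrN subrr mul0r.
apply: (@cvg_unique _ _ (\int[P]_w D n w @[n --> \oo])) => //; last first.
  by rewrite (_ : (fun n => _) = cst 0); [exact: cvg_cst|exact/funext].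
rewrite Rintegral_mkcond.
apply: (@dominated_convergence_Rintegral _ _ _ P D _ (fun w => `|W w|)).
- move=> n; apply: measurable_funM => //; apply: measurable_funB;
   apply: (measurableT_comp (measurable_clip a b));
      [apply: measurable_funD|apply: measurable_funB] => //; exact: measurable_funM.
- apply/measurable_restrict => //; first exact: measurable_trim.
  exact: measurable_funTS.
- apply: filterS (trim_ae_sides U a b hU) => w [Ua Ub].
  have [e e0 he] := huber_second_difference_local a b _ ab Ua Ub.
  apply: cvg_near_cst; near=> n.
  have [|_ De] := he (harmonic n * W w); first by near: n; exact: near_harmonic_lt.
  rewrite trim_if /D De; case: ifP => _; last by rewrite mul0r.
  by rewrite mulrA mulrAC mulfV ?mul1r// mulf_neq0 ?gt_eqF.
- apply: (std_normal_quadratic_integrable P U W _ 1) => //.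
    exact: measurableT_comp.
  move=> w; rewrite normr_id; have := sqr_ge0 (U w); have := sqr_ge0 (W w - 1).
  by have := sqr_ge0 (W w + 1); case: (ger0P (W w)) => ? ? ? ?; nra.
- move=> n w; have := clip_lipschitz a b (U w + harmonic n * W w) (U w - harmonic n * W w).
  have -> (u x : R) : u + x - (u - x) = 2 * x by ring.
  rewrite mulrA normrM => H.
  rewrite /D normrM normfV ler_pdivrMr ?normr_gt0 ?mulf_neq0 ?gt_eqF//.
  by rewrite [leRHS]mulrC.
Unshelve. all: by end_near. Qed.

End difference_quotients.

(** * Trimmed moments, the variance inequality and the trace formula *)

Section trimmed_moments.
Context {dT : measure_display} {T : measurableType dT} {R : realType}.
Variable P : probability T R.
Implicit Types (U W : T -> R) (a b m : R).

Definition trim_prob a b : R := fine (normal_prob 0 1 `[a, b]%classic).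

Definition trim_moment a b k : R := \int[normal_prob 0 1]_(x in `[a, b]) x ^+ k.

(** The constant K. Defining it as a limit makes it depend on a and b only; any standard pair
    supplies the convergence when a <= b. *)
Definition cross_moment a b : R := limn (second_difference_mean a b).

Lemma trim_probE U a b : has_law P U (normal_prob 0 1) ->
  fine (P (trim U a b)) = trim_prob a b.
Proof.
move=> [mU lU]; rewrite /trim_prob -lU//; congr (fine (P _)).
Qed.

Lemma trim_momentE U a b k : has_law P U (normal_prob 0 1) ->
  \int[P]_(w in trim U a b) U w ^+ k = trim_moment a b k.
Proof.
move=> hU; rewrite /trim_moment Rintegral_mkcond [RHS]Rintegral_mkcond.
rewrite -(has_law_integral P _ (normal_prob 0 1)
   ((fun x : R => x ^+ k) \_ `[a, b]%classic) hU).
  apply: eq_Rintegral => w _; rewrite trim_if patchE.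
  by rewrite mem_setE/= in_itv.
apply/measurable_restrict => //; apply: measurable_funTS; exact: exprn_measurable.
Qed.

Lemma cross_momentE U W a b : a <= b -> std_gaussian_pair P U W ->
  \int[P]_(w in trim U a b) W w ^+ 2 = cross_moment a b.
Proof.
move=> ab hUW; apply/esym/cvg_lim => //; exact: cvg_second_difference_mean.
Qed.

Lemma std_normal_integrable U : has_law P U (normal_prob 0 1) ->
  P.-integrable setT (EFin \o U).
Proof.
move=> hU; apply: (std_normal_quadratic_integrable P U U _ 1) => //; first by case: hU.
move=> w; have := sqr_ge0 (U w - 1); have := sqr_ge0 (U w + 1).
by case: (ger0P (U w)) => ? ? ?; nra.
Qed.

Lemma std_gaussian_pair_mean0 U W : std_gaussian_pair P U W -> \int[P]_w U w = 0.
Proof.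
move=> hUW; have hU := std_gaussian_pair_l P _ _ hUW.
have hN : has_law P (fun w => - U w) (normal_prob 0 1).
  have := hUW (-1) 0; rewrite sqrrN expr1n expr0n addr0 sqrtr1 => /(_ ltr01).
  by under eq_fun do rewrite mulN1r mul0r addr0.
have e1 := has_law_integral P _ (normal_prob 0 1) id hU (@measurable_id _ _ _).
have := has_law_integral P _ (normal_prob 0 1) id hN (@measurable_id _ _ _).
rewrite -e1; under eq_Rintegral do rewrite -mulN1r.
rewrite RintegralZl//; last exact: std_normal_integrable.
move=> /=; lra.
Qed.

(** With t = sqrt(1 + h^2), h^2 = (t - 1) (t + 1) turns the quotient into 2 / (t + 1). *)
Lemma cvg_dilation_rate :
  2 * (Num.sqrt (1 + harmonic n ^+ 2) - 1) / harmonic n ^+ 2 @[n --> \oo] --> (1 : R).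
Proof.
have h0 n : 0 < harmonic n :> R by rewrite harmonic_gt0.
under eq_fun => n.
  have s0 : 0 <= Num.sqrt (1 + harmonic n ^+ 2) :> R by exact: sqrtr_ge0.
  have -> : 2 * (Num.sqrt (1 + harmonic n ^+ 2) - 1) / harmonic n ^+ 2 =
    2 / (Num.sqrt (1 + harmonic n ^+ 2) + 1) :> R.
    have e : Num.sqrt (1 + harmonic n ^+ 2) ^+ 2 = 1 + harmonic n ^+ 2 :> R.
      by rewrite sqr_sqrtr// addr_ge0// sqr_ge0.
    have n0 : harmonic n != 0 :> R by rewrite gt_eqF.
    set t := Num.sqrt _ in s0 e *.
    have t0 : t + 1 != 0 by rewrite gt_eqF// ltr_wpDl.
    have hE : harmonic n ^+ 2 = (t - 1) * (t + 1) by rewrite -subr_sqr e expr1n addrC addKr.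
    have t1 : t - 1 != 0.
      by apply: contra_neq (expf_neq0 2 n0) => t1; rewrite hE t1 mul0r.
    by rewrite hE; field; apply/andP.
  over.
suff : 2 / (Num.sqrt (1 + harmonic n ^+ 2) + 1) @[n --> \oo] -->
    (2 / (Num.sqrt (1 + 0 ^+ 2) + 1) : R) by rewrite expr0n addr0 sqrtr1 divff.
apply: cvgM; first exact: cvg_cst.
apply: cvgV; first by rewrite expr0n addr0 sqrtr1.
apply: cvgD; last exact: cvg_cst.
apply: (cvg_comp _ (@Num.sqrt R)); last exact: sqrt_continuous.
apply: cvgD; first exact: cvg_cst.
apply: (cvg_comp _ (fun x : R => x ^+ 2)); last exact: sqr_continuous.
exact: cvg_harmonic.
Qed.

(** Integrate [huber_dilation] at x = U, divide by h^2 / 2 and let h tend to 0. The parameter m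
    stays free here and is later the conditional mean. *)
Lemma trim_moment_le_cross_moment U W a b m : a <= 0 <= b -> a <= m <= b ->
  std_gaussian_pair P U W ->
  trim_moment a b 2 - m * trim_moment a b 1 <= cross_moment a b.
Proof.
move=> a0b amb hUW; have hU := std_gaussian_pair_l P _ _ hUW.
have ab : a <= b by case/andP: a0b; exact: le_trans.
have mU : measurable_fun setT U by case: hU.
have iU := std_normal_integrable U hU.
have iU2 := normal_square_integrable P U hU.
have mA : measurable (trim U a b) by exact: measurable_trim.
set J := trim_moment a b 2 - _.
have i12 : P.-integrable setT (EFin \o (fun w => U w ^+ 2 - m * U w)).
  exact: (integrableB measurableT iU2 (integrableZl measurableT m iU)).
have iA : P.-integrable setT
    (EFin \o ((fun w => U w ^+ 2 - m * U w) \_ (trim U a b))).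
  rewrite -restrict_EFin; apply/(integrable_mkcond _ mA).
  exact: (integrableS measurableT mA (@subsetT _ _) i12).
have JE : \int[P]_w ((fun w => U w ^+ 2 - m * U w) \_ (trim U a b)) w = J.
  rewrite -Rintegral_mkcond RintegralB//; first last.
  - apply: (integrableS measurableT) => //.
    exact: (integrableZl measurableT m iU).
  - exact: (integrableS measurableT).
  rewrite RintegralZl//; last exact: (integrableS measurableT).
  by rewrite (trim_momentE U)// /J -(trim_momentE U a b 1).
rewrite -[J]mul1r -(cross_momentE U W)//.
have cJ : 2 * (Num.sqrt (1 + harmonic n ^+ 2) - 1) / harmonic n ^+ 2 * J
    @[n --> \oo] --> 1 * J.
  by apply: cvgM; [exact: cvg_dilation_rate|exact: cvg_cst].
apply: (ler_cvg_to cJ (cvg_second_difference_mean P U W a b ab hUW)).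
apply: nearW => n /=.
have h0 : 0 < harmonic n :> R by rewrite harmonic_gt0.
set t := Num.sqrt _.
have t1 : 1 <= t by rewrite -[leLHS]sqrtr1 ler_wsqrtr// lerDl sqr_ge0.
rewrite /second_difference_mean -/t mulrAC ler_wpM2r ?invr_ge0 ?sqr_ge0//.
rewrite -mulrA ler_wpM2l//.
have st : Num.sqrt (t ^+ 2 + 0 ^+ 2) = t.
  by rewrite expr0n addr0 sqrtr_sqr ger0_norm// (le_trans _ t1).
have s1 : Num.sqrt (1 ^+ 2 + 0 ^+ 2) = 1 :> R by rewrite expr0n addr0 expr1n sqrtr1.
(* N(0, 1 + h^2) is now realized as the law of t U instead of U + h W, which allows a pointwise
   comparison. *)
have -> : huber_mean a b t = \int[P]_w huber a b (t * U w + 0 * W w).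
  have t2 : 0 < t ^+ 2 + 0 ^+ 2 by rewrite expr0n addr0 exprn_gt0// (lt_le_trans _ t1).
  by rewrite (std_gaussian_pair_huber_mean P U W a b t 0 hUW t2) st.
have -> : huber_mean a b 1 = \int[P]_w huber a b (1 * U w + 0 * W w).
  have one2 : 0 < 1 ^+ 2 + 0 ^+ 2 :> R by rewrite expr0n addr0 expr1n.
  by rewrite (std_gaussian_pair_huber_mean P U W a b 1 0 hUW one2) s1.
(* The linear term can be inserted because U has mean 0. *)
have -> : \int[P]_w huber a b (t * U w + 0 * W w) - \int[P]_w huber a b (1 * U w + 0 * W w)
  = \int[P]_w (huber a b (t * U w + 0 * W w) - huber a b (1 * U w + 0 * W w)
               - (t - 1) * m * U w).
  have i1 := std_gaussian_pair_huber_integrable P U W a b t 0 ab hUW.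
  have i2 := std_gaussian_pair_huber_integrable P U W a b 1 0 ab hUW.
  have i3 : P.-integrable setT (EFin \o (fun w =>
      huber a b (t * U w + 0 * W w) - huber a b (1 * U w + 0 * W w))).
    exact: (integrableB measurableT i1 i2).
  have i4 : P.-integrable setT (EFin \o (fun w => (t - 1) * m * U w)).
    exact: (integrableZl measurableT ((t - 1) * m) iU).
  by rewrite [RHS]RintegralB// RintegralB// RintegralZl// (std_gaussian_pair_mean0 _ _ hUW) mulr0 subr0.
rewrite -JE -RintegralZl//.
apply: le_Rintegral => //.
- exact: (integrableZl measurableT (t - 1) iA).
- have i1 := std_gaussian_pair_huber_integrable P U W a b t 0 ab hUW.
  have i2 := std_gaussian_pair_huber_integrable P U W a b 1 0 ab hUW.
  exact: (integrableB measurableT (integrableB measurableT i1 i2)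
     (integrableZl measurableT ((t - 1) * m) iU)).
move=> w _; rewrite trim_if !mul0r !addr0 mul1r; exact: huber_dilation.
Qed.

(** Take m to be the conditional mean, which lies in [a, b]; then the second moment minus m times
    the first is p times the conditional variance. *)
Lemma trim_variance_le U W a b : a <= 0 <= b -> std_gaussian_pair P U W ->
  trim_moment a b 2 / trim_prob a b - (trim_moment a b 1 / trim_prob a b) ^+ 2
  <= cross_moment a b / trim_prob a b.
Proof.
move=> a0b hUW; have hU := std_gaussian_pair_l P _ _ hUW.
have mU : measurable_fun setT U by case: hU.
have mA : measurable (trim U a b) by exact: measurable_trim.
have iU : P.-integrable (trim U a b) (EFin \o U).
  by apply: (integrableS measurableT) => //; exact: std_normal_integrable.
have : 0 <= trim_prob a b by exact: fine_ge0.
(* If p = 0, every quotient is 0 by the convention for the inverse of 0. *)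
rewrite le_eqVlt => /predU1P[<-|p0]; first by rewrite invr0 !mulr0 expr0n subr0.
have am : a * trim_prob a b <= trim_moment a b 1.
  rewrite -(trim_momentE U)// -(trim_probE U)// -Rintegral_cst//.
  apply: le_Rintegral => //; first exact: finite_measure_integrable_cst.
  by move=> w /andP[].
have mb : trim_moment a b 1 <= b * trim_prob a b.
  rewrite -(trim_momentE U)// -(trim_probE U)// -Rintegral_cst//.
  apply: le_Rintegral => //; first exact: finite_measure_integrable_cst.
  by move=> w /andP[].
have := trim_moment_le_cross_moment U W a b (trim_moment a b 1 / trim_prob a b) a0b _ hUW.
rewrite ler_pdivlMr// ler_pdivrMr// am mb => /(_ isT) le.
rewrite expr2 mulrA -mulrBl ler_wpM2r// ?invr_ge0 ?(ltW p0)//.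
Qed.

(** Only diagonal entries count: j != i gives s_j^2 K / p, the conditional mean being 0, and j = i
    gives s_i^2 v. Completing the sum with the missing term s_i^2 K / p isolates the dependence on
    i. *)
Lemma trace_condCov_trim (n : nat) (s : 'I_n -> R) (U : 'I_n -> T -> R) a b (i : 'I_n) :
  a <= b -> has_law P (U i) (normal_prob 0 1) ->
  (forall j, j != i -> std_gaussian_pair P (U i) (U j)) ->
  \tr (condCov P (fun j w => s j * U j w) (trim (U i) a b)) =
  (\sum_j s j ^+ 2) * (cross_moment a b / trim_prob a b) -
  s i ^+ 2 * (cross_moment a b / trim_prob a b - 
    (trim_moment a b 2 / trim_prob a b - (trim_moment a b 1 / trim_prob a b) ^+ 2)).
Proof.
move=> ab hUi hU.
have hUj j : has_law P (U j) (normal_prob 0 1).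
  have [->//|ji] := eqVneq j i.
  exact: std_gaussian_pair_l (std_gaussian_pairC _ _ _ (hU j ji)).
have mA : measurable (trim (U i) a b) by apply: measurable_trim; case: hUi.
have E1 j : condE P (trim (U i) a b) (fun w => s j * U j w) =
    s j * (\int[P]_(w in trim (U i) a b) U j w / trim_prob a b).
  rewrite /condE (trim_probE (U i))// RintegralZl// ?mulrA//.
  by apply: (integrableS measurableT) => //; exact: std_normal_integrable.
have E2 j : condE P (trim (U i) a b) (fun w => s j * U j w * (s j * U j w)) =
    s j ^+ 2 * (\int[P]_(w in trim (U i) a b) U j w ^+ 2 / trim_prob a b).
  rewrite /condE (trim_probE (U i))//.
  under eq_Rintegral do rewrite mulrACA -!expr2.
  rewrite RintegralZl// ?mulrA//.
  by apply: (integrableS measurableT) => //; exact: normal_square_integrable.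
rewrite /mxtrace (bigD1 i)//= mxE E2 E1 (trim_momentE (U i))//.
have -> : \int[P]_(w in trim (U i) a b) U i w = trim_moment a b 1.
  by rewrite -(trim_momentE (U i)).
rewrite (eq_bigr (fun j => s j ^+ 2 * (cross_moment a b / trim_prob a b))); last first.
  move=> j ji; rewrite mxE E2 E1 (cross_momentE (U i))//; last exact: hU.
  by rewrite (Rintegral_trim_other P _ _ _ _ ab (hU j ji)) mul0r !mulr0 subr0.
rewrite -mulr_suml [in RHS](bigD1 i)//=; ring.
Qed.

End trimmed_moments.

(** * Quantiles under scaling and symmetry *)

Section quantile.
Context {dT : measure_display} {T : measurableType dT} {R : realType}.
Variable P : probability T R.
Implicit Types (W : T -> R) (p c : R).

Lemma inf_dilation_le (E : set R) c : 0 < c -> has_inf E ->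
  c * inf E <= inf [set x | E (x / c)].
Proof.
move=> c0 [[x Ex] lE]; apply: lb_le_inf.
  by exists (c * x) => /=; rewrite mulrC mulKf// gt_eqF.
by move=> y /= Ey; rewrite mulrC -ler_pdivlMr//; exact: ge_inf.
Qed.

Lemma has_inf_dilation (E : set R) c : 0 < c -> has_inf E ->
  has_inf [set x | E (x / c)].
Proof.
move=> c0 [[x Ex] [l lE]]; split.
  by exists (c * x) => /=; rewrite mulrC mulKf// gt_eqF.
by exists (l * c) => y /= Ey; rewrite -ler_pdivlMr//; exact: lE.
Qed.

(** Apply the one-sided inequality to c and to its inverse. *)
Lemma inf_dilation (E : set R) c : 0 < c ->
  inf [set x | E (x / c)] = c * inf E.
Proof.
move=> c0.
have EE : [set x | [set x | E (x / c)] (x / c^-1)] = E.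
  by apply/seteqP; split => x /=; rewrite invrK mulfK// gt_eqF.
have c1 : 0 < c^-1 by rewrite invr_gt0.
(* If E is empty or unbounded below, so is its dilation, and both infima have the default value
   0. *)
have [hE|hE] := pselect (has_inf E); last first.
  rewrite (inf_out hE) mulr0 inf_out// => hE'; apply: hE.
  by rewrite -EE; exact: has_inf_dilation.
apply/eqP; rewrite eq_le inf_dilation_le// andbT.
have := inf_dilation_le _ _ c1 (has_inf_dilation _ _ c0 hE).
by rewrite EE mulrC ler_pdivrMr// [_ * c]mulrC.
Qed.

Lemma quantileZ W c p : 0 < c -> quantile P (fun w => c * W w) p = c * quantile P W p.
Proof.
move=> c0; rewrite /quantile -inf_dilation//; congr inf.
apply/seteqP; split => x /=; congr (_ <= P _)%E; apply/seteqP; split => w /=;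
  by rewrite ler_pdivlMr// [_ * c]mulrC.
Qed.

Lemma lower_tailE W x : [set w | W w <= x] = W @^-1` `]-oo, x]%classic.
Proof. by apply/seteqP; split => w /=; rewrite in_itv. Qed.

Lemma quantile_eq_law W1 W2 mu p : has_law P W1 mu -> has_law P W2 mu ->
  quantile P W1 p = quantile P W2 p.
Proof.
move=> [m1 l1] [m2 l2]; congr inf; apply/seteqP; split => x /=;
  by rewrite !lower_tailE l1// l2.
Qed.

Section symmetric.
Variable W : T -> R.
Hypothesis mW : measurable_fun setT W.
Hypothesis symW : forall x, P [set w | - W w <= x] = P [set w | W w <= x].

Let mL x : measurable [set w | W w <= x].
Proof. by rewrite lower_tailE -[X in measurable X]setTI; exact: mW. Qed.

Let mNL x : measurable [set w | - W w <= x].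
Proof.
rewrite (lower_tailE (fun w => - W w)) -[X in measurable X]setTI.
by apply: measurableT_comp => //.
Qed.

(** The events W <= 0 and -W <= 0 cover the space and are equally likely. *)
Lemma symmetric_lower_tail_ge : (2^-1%:E <= P [set w | (W w <= 0)%R])%E.
Proof.
have : (1 <= P [set w | (W w <= 0)%R] + P [set w | (- W w <= 0)%R])%E.
  rewrite -(@probability_setT _ _ _ P).
  apply: le_trans (measureU2 P (mL 0) (mNL 0)).
  apply: le_measure; rewrite ?inE//; first exact: measurableU.
  by move=> w _ /=; rewrite oppr_le0; case: (leP (W w) 0) => [|/ltW]; [left|right].
rewrite symW -(fineK (fin_num_measure P _ (mL 0))) -EFinD !lee_fin; lra.
Qed.

(** For x < 0 the events W <= x and -W <= x are disjoint and equally likely. *)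
Lemma symmetric_lower_tail_le x : x < 0 -> (P [set w | (W w <= x)%R] <= 2^-1%:E)%E.
Proof.
move=> x0.
have : (P [set w | (W w <= x)%R] + P [set w | (- W w <= x)%R] <= 1)%E.
  rewrite -measureU//; first exact: probability_le1 (measurableU _ _ (mL x) (mNL x)).
  by apply/seteqP; split => // w /= [? ?]; lra.
rewrite symW -(fineK (fin_num_measure P _ (mL x))) -EFinD !lee_fin; lra.
Qed.

Lemma symmetric_quantile_le0 p : p <= 2^-1 -> quantile P W p <= 0.
Proof.
move=> p2; rewrite /quantile; set E := [set _ | _].
have E0 : E 0 by apply: le_trans symmetric_lower_tail_ge; rewrite lee_fin.
have [lE|lE] := pselect (has_lbound E); first exact: ge_inf.
by rewrite inf_out// => -[].
Qed.

(** Strictness matters: a symmetric law with a gap around 0 has P(W <= x) = 1/2 for some x < 0. *)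
Lemma symmetric_quantile_ge0 p : 2^-1 < p -> 0 <= quantile P W p.
Proof.
move=> p2; rewrite /quantile; set E := [set _ | _].
have [->|/set0P E0] := eqVneq E set0; first by rewrite inf0.
apply: lb_le_inf => // x Ex; rewrite leNgt; apply/negP => x0.
have := le_trans Ex (symmetric_lower_tail_le x x0).
by rewrite lee_fin leNgt p2.
Qed.

End symmetric.

End quantile.

(** * Standardized principal components *)

Section principal_components.
Context {dT : measure_display} {T : measurableType dT} {R : realType}.
Variable P : probability T R.

(** Test the Gaussian vector in the direction p v_i + q v_j, with p and q the coefficients x and y
    rescaled by the square roots of the eigenvalues; its variance is p^2 lambda_i + q^2 lambda_j =
    x^2 + y^2. *)
Lemma principal_components_std_gaussian_pair (n : nat) (Sigma V : 'M[R]_n)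
    (lambda : 'I_n -> R) (X : 'I_n -> T -> R) (i j : 'I_n) :
  V^T *m V = 1%:M ->
  (forall k, Sigma *m col k V = lambda k *: col k V) ->
  (forall k, 0 < lambda k) ->
  gaussian_vector P X Sigma -> i != j ->
  std_gaussian_pair P
    (fun w => (\sum_k V k i * X k w) / Num.sqrt (lambda i))
    (fun w => (\sum_k V k j * X k w) / Num.sqrt (lambda j)).
Proof.
move=> VV SV lam0 gX ij x y xy.
have orth k l : \sum_m V m k * V m l = (k == l)%:R.
  have /matrixP/(_ k l) := VV; rewrite !mxE => <-.
  by apply: eq_bigr => m _; rewrite !mxE.
have eig k l : \sum_m Sigma l m * V m k = lambda k * V l k.
  have /matrixP/(_ l 0) := SV k; rewrite !mxE => <-.
  by apply: eq_bigr => m _; rewrite !mxE.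
pose p := x / Num.sqrt (lambda i); pose q := y / Num.sqrt (lambda j).
have := gX (fun k => p * V k i + q * V k j).
rewrite (_ : \sum_k \sum_l _ = x ^+ 2 + y ^+ 2); last first.
  (* First the eigenvector equations, then orthonormality, which removes the cross term. *)
  transitivity (\sum_k (p * V k i + q * V k j) *
      (p * (lambda i * V k i) + q * (lambda j * V k j))).
    apply: eq_bigr => k _; rewrite -!eig !mulr_sumr -big_split/= mulr_sumr.
    by apply: eq_bigr => l _; ring.
  transitivity (p ^+ 2 * lambda i * (\sum_k V k i * V k i) +
    q ^+ 2 * lambda j * (\sum_k V k j * V k j) +
    p * q * (lambda i + lambda j) * (\sum_k V k i * V k j)).
    rewrite !mulr_sumr -!big_split/=; apply: eq_bigr => k _; ring.
  rewrite !orth !eqxx (negbTE ij) !mulr1 mulr0 addr0 /p /q.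
  rewrite !expr_div_n !sqr_sqrtr ?(ltW (lam0 _))// !divfK//; apply: lt0r_neq0; exact: lam0.
rewrite /= xy.
rewrite (_ : (fun w => \sum_k _) = (fun w => x * ((\sum_k V k i * X k w) / Num.sqrt (lambda i)) +
   y * ((\sum_k V k j * X k w) / Num.sqrt (lambda j))))//.
apply/funext => w.
rewrite mulrCA mulrC [y * _]mulrCA [_ * (y / _)]mulrC -/p -/q.
by rewrite !mulr_sumr -big_split; apply: eq_bigr => k _; rewrite mulrDl !mulrA.
Qed.

Lemma trim_eventZ (W : T -> R) (c alpha : R) : 0 < c ->
  trim_event P (fun w => c * W w) alpha =
  trim W (quantile P W (alpha / 2)) (quantile P W (1 - alpha / 2)).
Proof.
move=> c0; rewrite /trim_event !quantileZ//.
by apply/seteqP; split => w /=; rewrite !ler_pM2l.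
Qed.

(** Symmetry of U comes from the coefficients (-1, 0), and alpha/2 < 1/2 < 1 - alpha/2. *)
Lemma std_gaussian_pair_quantile U W (alpha : R) : 0 < alpha < 1 ->
  std_gaussian_pair P U W ->
  quantile P U (alpha / 2) <= 0 <= quantile P U (1 - alpha / 2).
Proof.
move=> /andP[a0 a1] hUW; have [mU lU] := std_gaussian_pair_l P _ _ hUW.
have symU x : P [set w | - U w <= x] = P [set w | U w <= x].
  have := hUW (-1) 0; rewrite sqrrN expr1n expr0n addr0 sqrtr1 => /(_ ltr01).
  under eq_fun do rewrite mulN1r mul0r addr0.
  by move=> [_ lN]; rewrite (lower_tailE (fun w => - U w)) lower_tailE lN// lU.
apply/andP; split.
- by apply: (symmetric_quantile_le0 P U mU symU); lra.
- by apply: (symmetric_quantile_ge0 P U mU symU); lra.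
Qed.

End principal_components.

(** * Comparison of the traces over the peeled component *)

Theorem theorem5 (dT : measure_display) (T : measurableType dT) (R : realType)
  (P : probability T R) (d : nat)
  (Sigma : 'M[R]_d.+1) (lambda : 'I_d.+1 -> R) (V : 'M[R]_d.+1)
  (X : 'I_d.+1 -> T -> R) (alpha : R) :
  Sigma^T = Sigma ->
  (forall u : 'rV[R]_d.+1, u != 0 -> 0 < (u *m Sigma *m u^T) 0 0) ->
  V^T *m V = 1%:M ->
  (forall j : 'I_d.+1, Sigma *m col j V = lambda j *: col j V) ->
  (forall j k : 'I_d.+1, (j <= k)%N -> lambda k <= lambda j) ->
  (forall j, 0 < lambda j) ->
  gaussian_vector P X Sigma ->
  0 < alpha < 1 ->
  let Y := fun (i : 'I_d.+1) (w : T) => \sum_(j < d.+1) V j i * X j w in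
  let Lambda := fun i : 'I_d.+1 => condCov P Y (trim_event P (Y i) alpha) in
  forall i : 'I_d.+1,
    \tr (Lambda ord0) <= \tr (Lambda i) /\ \tr (Lambda i) <= \tr (Lambda ord_max).
Proof.
move=> _ _ VV SV lam_mono lam0 gX alpha01 Y Lambda.
pose U i w := Y i w / Num.sqrt (lambda i).
have s0 i : 0 < Num.sqrt (lambda i) by rewrite sqrtr_gt0.
have YE : Y = (fun i w => Num.sqrt (lambda i) * U i w).
  by apply/funext => i; apply/funext => w; rewrite /U mulrC divfK// gt_eqF.
have pairU i j : i != j -> std_gaussian_pair P (U i) (U j).
  exact: principal_components_std_gaussian_pair VV SV lam0 gX.
(* Distinct indices are required because K is identified through a pair of different components. *)
have mono i1 i2 : i1 != i2 -> lambda i2 <= lambda i1 ->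
    \tr (Lambda i1) <= \tr (Lambda i2).
  move=> i12 lam21.
  have h1 := pairU _ _ i12.
  have h2 : std_gaussian_pair P (U i2) (U i1) by apply: pairU; rewrite eq_sym.
  have q12 p : quantile P (U i1) p = quantile P (U i2) p.
    exact: quantile_eq_law (std_gaussian_pair_l _ _ _ h1) (std_gaussian_pair_l _ _ _ h2).
  have a0b := std_gaussian_pair_quantile P _ _ _ alpha01 h1.
  have ab : quantile P (U i1) (alpha / 2) <= quantile P (U i1) (1 - alpha / 2).
    by case/andP: a0b; exact: le_trans.
  have others i j : j != i -> std_gaussian_pair P (U i) (U j).
    by rewrite eq_sym; exact: pairU.
  (* Both events now trim standard variables to the same interval, so the two traces share K, p and
     v. *)
  rewrite /Lambda YE !trim_eventZ// -!q12.
  rewrite (trace_condCov_trim P _ _ _ _ _ _ ab (std_gaussian_pair_l _ _ _ h1) (others i1)).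
  rewrite (trace_condCov_trim P _ _ _ _ _ _ ab (std_gaussian_pair_l _ _ _ h2) (others i2)).
  (* What differs is lambda_i (K / p - v), so the claim reduces to v <= K / p. *)
  rewrite !sqr_sqrtr ?(ltW (lam0 _))// lerD2l lerN2 ler_wpM2r// subr_ge0.
  exact: trim_variance_le h1.
move=> i; split.
- by have [<-//|i0] := eqVneq ord0 i; apply: mono => //; exact: lam_mono.
- by have [->//|i0] := eqVneq i ord_max; apply: mono => //; apply: lam_mono; exact: leq_ord.
Qed.
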